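(* Let $\{X_n;n\ge1\}$ and $\{Y_n;n\ge1\}$ be two sequences of independent non-negative continuous random variables, where $Y_n$ has distribution function $F_n$ with $\overline F_n(t)>0$ for all $t\ge0$. Let $\{T'_n\}$ (counting process $N'$) be the failure times of the replacement-by-a-new-unit process based on $\{X_n\}$, and $\{T_n\}$ (counting process $N$) the failure times of the relevation process based on $\{F_n\}$. If (a) $X_1\ge_{\mathrm{st}}Y_1$, and (b) $X_n\ge_{\mathrm{st}}[Y_n-t\mid Y_n>t]$ for all $n\ge2$ and all $t>0$, then $(T'_1,\ldots,T'_n)\ge_{\mathrm{st}}(T_1,\ldots,T_n)$ for all $n\ge1$ and $N'(t)\le_{\mathrm{st}}N(t)$ for all $t\ge0$. Likewise, if (a) and (b) hold with $\le_{\mathrm{st}}$ in place of $\ge_{\mathrm{st}}$, then $(T'_1,\ldots,T'_n)\le_{\mathrm{st}}(T_1,\ldots,T_n)$ for all $n\ge 1$ and $N'(t)\ge_{\mathrm{st}}N(t)$ for all $t\ge0$.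
   Context: Relevation process based on $\{F_n\}$: random times $0<T_1<T_2<\cdots$ with $T_1\sim F_1$ and, for $i\ge2$, conditionally on $T_1=t_1,\ldots,T_{i-1}=t_{i-1}$ ($0<t_1<\cdots<t_{i-1}$), $P(T_i>t\mid\cdot)=\overline F_i(t)/\overline F_i(t_{i-1})$ for $t\ge t_{i-1}$; $N(t)=\sup\{n:T_n\le t\}$. Replacement-by-a-new-unit process: $T'_n=X_1+\cdots+X_n$, $N'(t)=\sup\{n:T'_n\le t\}$. $X\le_{\mathrm{st}}Y$ for random variables means $P(X>t)\le P(Y>t)$ for all $t$; for random vectors it means $E[\phi(\mathbf X)]\le E[\phi(\mathbf Y)]$ for all componentwise increasing $\phi$ for which the expectations exist. *)

(* Defs.v *)
From HB Require Import structures.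
From mathcomp Require Import all_boot all_order all_algebra.
From mathcomp Require Import all_classical all_reals all_analysis.
Set Implicit Arguments. Unset Strict Implicit. Unset Printing Implicit Defensive.
Import Order.TTheory GRing.Theory Num.Theory.
Import numFieldNormedType.Exports.
Local Open Scope classical_set_scope.
Local Open Scope ring_scope.

(* Conventions: all sequences are indexed from 0, i.e. [X 0] is the paper's
   X_1, [X k] is X_{k+1}. *)

Definition mutually_independent d (Omega : measurableType d) (R : realType)
    (P : probability Omega R) (X : nat -> Omega -> R) : Prop :=
  forall (s : seq nat) (B : nat -> set R),
    uniq s -> (forall i, measurable (B i)) ->
    fine (P (\bigcap_(i in [set` s]) (X i @^-1` B i))) =
    \prod_(i <- s) fine (P (X i @^-1` B i)).

Definition continuous_rv d (Omega : measurableType d) (R : realType)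
    (P : probability Omega R) (X : {RV P >-> R}) : Prop :=
  continuous (fun r : R => fine (cdf X r)).

Definition condprob d (Omega : measurableType d) (R : realType)
    (P : probability Omega R) (A B : set Omega) : R :=
  fine (P (A `&` B)) / fine (P B).

Definition rvec (Omega : Type) (R : Type) (n : nat) (Z : nat -> Omega -> R)
    (w : Omega) : n.-tuple R :=
  [tuple Z (nat_of_ord i) w | i < n].

Definition coord_increasing (R : realType) (n : nat) (phi : n.-tuple R -> R) :=
  forall x y : n.-tuple R,
    (forall i : 'I_n, tnth x i <= tnth y i) -> phi x <= phi y.

(* Usual multivariate stochastic order  V1 <=st V2 :
   E[phi(V1)] <= E[phi(V2)] for every (Borel) componentwise increasing phi
   for which both expectations exist (taken here: are finite, integrable). *)
Definition st_le_vec (R : realType) (n : nat)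
    d1 (O1 : measurableType d1) (P1 : probability O1 R) (V1 : O1 -> n.-tuple R)
    d2 (O2 : measurableType d2) (P2 : probability O2 R) (V2 : O2 -> n.-tuple R)
  : Prop :=
  forall phi : n.-tuple R -> R,
    measurable_fun setT phi -> coord_increasing phi ->
    P1.-integrable setT (fun w => (phi (V1 w))%:E) ->
    P2.-integrable setT (fun w => (phi (V2 w))%:E) ->
    (\int[P1]_w (phi (V1 w))%:E <= \int[P2]_w (phi (V2 w))%:E)%E.

Definition st_le_ext (R : realType)
    d1 (O1 : measurableType d1) (P1 : probability O1 R) (Z1 : O1 -> \bar R)
    d2 (O2 : measurableType d2) (P2 : probability O2 R) (Z2 : O2 -> \bar R)
  : Prop :=
  forall r : R, (P1 [set w | (r%:E < Z1 w)%E] <= P2 [set w | (r%:E < Z2 w)%E])%E.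

Definition renewal_times (Omega : Type) (R : realType) (X : nat -> Omega -> R)
    (k : nat) (w : Omega) : R :=
  \sum_(i < k.+1) X (nat_of_ord i) w.

(* Counting process N(t) = sup {n : T_n <= t} (with sup of the empty set = 0);
   extended-real valued, since it may be infinite.  T k is T_{k+1}. *)
Definition count_proc (Omega : Type) (R : realType) (T : nat -> Omega -> R)
    (t : R) (w : Omega) : \bar R :=
  ereal_sup ([set 0%E] `|` [set ((k.+1)%:R)%:E | k in [set k | T k w <= t]]).

(* Relevation process based on the distribution functions F_n of Y_n
   (survival function  Fbar_{k+1}(t) = P(Y k > t) = ccdf (Y k) t):
   0 < T_1 < T_2 < ..., T_1 ~ F_1, and for i >= 2, conditionally on
   (T_1,...,T_{i-1}) = (t_1,...,t_{i-1}),
   P(T_i > t | .) = Fbar_i(t)/Fbar_i(t_{i-1}) for t >= t_{i-1}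
   (and = 1 for t < t_{i-1}).  The conditional statement is expressed in
   its defining integrated form over every Borel set A of R^{i-1}. *)
Definition relevation_process (R : realType)
    d (Omega : measurableType d) (Q : probability Omega R)
    (T : nat -> {RV Q >-> R})
    d' (Omega' : measurableType d') (P : probability Omega' R)
    (Y : nat -> {RV P >-> R}) : Prop :=
  [/\ forall w, 0 < T 0%N w,
      forall k w, T k w < T k.+1 w,
      forall t : R, ccdf (T 0%N) t = ccdf (Y 0%N) t &
      forall (i : nat) (A : set (i.+1.-tuple R)) (t : R),
        measurable A ->
        Q ((@rvec Omega R i.+1 (fun k => T k)) @^-1` A
             `&` [set w | t < T i.+1 w]) =
        (\int[Q]_(w in (@rvec Omega R i.+1 (fun k => T k)) @^-1` A)
           (if t < T i w then 1
            else fine (ccdf (Y i.+1) t) / fine (ccdf (Y i.+1) (T i w)))%:E)%E].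

(* Main.v *)
Require Import Defs.
From HB Require Import structures.
From mathcomp Require Import all_boot all_order all_algebra.
From mathcomp Require Import all_classical all_reals all_analysis
  measurable_realfun.

From mathcomp Require Import lra.
Import Order.TTheory GRing.Theory Num.Theory.
Import numFieldNormedType.Exports.
Local Open Scope classical_set_scope.
Local Open Scope ring_scope.

Set Implicit Arguments.
Unset Strict Implicit.
Unset Printing Implicit Defensive.

(* The law of the next failure time given the past increases with the last
   failure time for the renewal process, and on either side it is compared with
   the other process by (a) and (b).  Hence, for [f] increasing with values in
   [0, 1], the coordinates can be exchanged one at a time:
     E f(T_1, .., T_n+1) <= E f(T_1, .., T_n, T_n + X_n+1) = E (M f)(T_1, .., T_n)
       <= E (M f)(T'_1, .., T'_n) = E f(T'_1, .., T'_n+1),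
   where M f (v) = E f(v, v_n + X_n+1) is again increasing with values in [0, 1];
   the second inequality is the induction hypothesis and the last equality the
   independence of X_n+1 from the past.  The first inequality is proved for
   indicators of sets with up-closed last sections, from the products
   A x ]t, +oo[ that the hypotheses control. *)

(** * Expectations compared through tail probabilities *)

(** The expectation is the integral of the survival function over the positive half-line minus that
    of the distribution function over the negative one; larger tails raise the first and lower the
    second. *)
Lemma expectation_le_of_tail (R : realType)
    d1 (O1 : measurableType d1) (P1 : probability O1 R) (f1 : O1 -> R)
    d2 (O2 : measurableType d2) (P2 : probability O2 R) (f2 : O2 -> R) :
  P1.-integrable setT (EFin \o f1) -> P2.-integrable setT (EFin \o f2) ->
  (forall r : R, (P1 [set w | (r < f1 w)%R] <= P2 [set w | (r < f2 w)%R])%E) ->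
  (\int[P1]_w (f1 w)%:E <= \int[P2]_w (f2 w)%:E)%E.
Proof.
move=> i1 i2 H.
have mf1 : measurable_fun setT f1 by exact/measurable_EFinP/(measurable_int _
  i1).
have mf2 : measurable_fun setT f2 by exact/measurable_EFinP/(measurable_int _
  i2).
pose X1 : {RV P1 >-> R} := HB.pack f1 (isMeasurableFun.Build _ _ _ _ f1 mf1).
pose X2 : {RV P2 >-> R} := HB.pack f2 (isMeasurableFun.Build _ _ _ _ f2 mf2).
have e1 : (\int[P1]_w (f1 w)%:E = 'E_P1[X1])%E by rewrite unlock.
have e2 : (\int[P2]_w (f2 w)%:E = 'E_P2[X2])%E by rewrite unlock.
have Hc r : (ccdf X1 r <= ccdf X2 r)%E.
  have := H r; rewrite /ccdf /distribution /pushforward /=.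
  by rewrite !set_itvoy.
rewrite e1 e2 !expectation_cdf_ccdf; [|exact/Lfun1_integrable..].
apply: leeB; apply: ge0_le_integral => //=.
- by apply: measurable_funTS; exact: ccdf_measurable.
- by apply: measurable_funTS; exact: ccdf_measurable.
- by apply: measurable_funTS; exact: cdf_measurable.
- by apply: measurable_funTS; exact: cdf_measurable.
- by move=> r _; rewrite !cdf_1_ccdf; apply: leeB.
Qed.

Lemma measurable_preimageT d1 d2 (T1 : measurableType d1) (T2 : measurableType
  d2)
    (f : T1 -> T2) (A : set T2) :
  measurable_fun setT f -> measurable A -> measurable (f @^-1` A).
Proof. by move=> mf mA; rewrite -[_ @^-1` _]setTI; exact: mf. Qed.

Lemma measurable_tail (R : realType) d (T : measurableType d) (f : T -> R) t :
  measurable_fun setT f -> measurable [set w | t < f w].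
Proof.
move=> mf; rewrite -[X in measurable X]/(f @^-1` [set r | t < r]) -set_itvoy.
exact: measurable_preimageT.
Qed.

(** * Events with up-closed last sections *)

(** [S] carries no order: when one coordinate is exchanged, the past is common to both sides and
    only the last time changes. *)
Definition up_sections (R : realType) (S : Type) (E : set (S * R)) :=
  forall v s t, s <= t -> E (v, s) -> E (v, t).

(* Cutting [R] along a grid of step [e / 2] traps [E], up to a shift of its
   sections by [e], in a countable disjoint union of products
   [seqDU A k `*` `]t_k, +oo[], to which the hypothesis applies. *)
Lemma tail_le_shift (R : realType) d (S : measurableType d)
    d1 (O1 : measurableType d1) (P1 : probability O1 R) (V1 : O1 -> S) (Z1 : O1
      -> R)
    d2 (O2 : measurableType d2) (P2 : probability O2 R) (V2 : O2 -> S) (Z2 : O2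
      -> R) :
  measurable_fun setT V1 -> measurable_fun setT V2 ->
  measurable_fun setT Z1 -> measurable_fun setT Z2 ->
  (forall w, 0 <= Z1 w) ->
  (forall A (t : R), measurable A ->
     (P1 (V1 @^-1` A `&` [set w | (t < Z1 w)%R]) <=
      P2 (V2 @^-1` A `&` [set w | (t < Z2 w)%R]))%E) ->
  forall E (e : R), measurable E -> up_sections E -> 0 < e ->
  (P1 [set w | E (V1 w, Z1 w)] <= P2 [set w | E (V2 w, (Z2 w + e)%R)])%E.
Proof.
move=> mV1 mV2 mZ1 mZ2 Z10 H E e2 mE uE e20.
(* Two grid steps make up the shift: one is lost in rounding [Z1 w] up to the grid, the other makes
   [k%:R * e - e2 < Z1 w] strict. *)
pose e := e2 / 2; have e0 : 0 < e by rewrite divr_gt0.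
have e2E : e2 = e + e by rewrite /e -splitr.
pose A k := [set v | E (v, k%:R * e)].
have mA k : measurable (A k).
  by apply: (@measurable_preimageT _ _ _ _ (fun v : S => (v, k%:R * e)) E) =>
    //.
(* [seqDU A k] holds the pasts whose section of [E] is first met at the grid point [k%:R * e]. *)
have mD k : measurable (seqDU A k).
  by apply: measurableD => //; exact: bigsetU_measurable.
pose B1 k := V1 @^-1` (seqDU A k) `&` [set w | k%:R * e - e2 < Z1 w].
pose B2 k := V2 @^-1` (seqDU A k) `&` [set w | k%:R * e - e2 < Z2 w].
have mB1 k : measurable (B1 k).
  by apply: measurableI; [exact: measurable_preimageT|exact: measurable_tail].
have mB2 k : measurable (B2 k).
  by apply: measurableI; [exact: measurable_preimageT|exact: measurable_tail].
have tD := @trivIset_seqDU _ A.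
have tB1 : trivIset setT B1.
  by apply: trivIset_setIr => i j _ _ [w [wi wj]]; apply: (tD i j) => //;
    exists (V1 w).
have tB2 : trivIset setT B2.
  by apply: trivIset_setIr => i j _ _ [w [wi wj]]; apply: (tD i j) => //;
    exists (V2 w).
have mE1 : measurable [set w | E (V1 w, Z1 w)].
  by apply: (@measurable_preimageT _ _ _ _ (fun w => (V1 w, Z1 w)) E) => //;
    exact: measurable_fun_pair.
have mE2 : measurable [set w | E (V2 w, Z2 w + e2)].
  apply: (@measurable_preimageT _ _ _ _ (fun w => (V2 w, Z2 w + e2)) E) => //.
  by apply: measurable_fun_pair => //; exact: measurable_funD.
apply: (@le_trans _ _ (P1 (\bigcup_k B1 k))).
  apply: le_measure; rewrite ?inE//; first exact: bigcupT_measurable.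
  move=> w /= Ew; pose k := (Num.truncn (Z1 w / e)).+1.
  have [k1 k2] : Z1 w <= k%:R * e /\ k%:R * e - e2 < Z1 w.
    have /andP[h1 h2] : (k.-1)%:R <= Z1 w / e < k%:R.
      by apply: truncn_itv; rewrite divr_ge0// ltW.
    move: h1 h2; rewrite ler_pdivlMr// ltr_pdivrMr// => h1 h2.
    split; first exact: ltW.
    rewrite /k -natr1 mulrDl e2E mul1r; move: h1 => /=; lra.
  have : (\bigcup_k A k) (V1 w) by exists k => //=; apply: uE Ew.
  rewrite seqDU_bigcup_eq => -[j _ Aj]; exists j => //; split => //=.
  (* The section is met no later than at [k], so the threshold at [j] is no higher than the one at
     [k]. *)
  have jk : (j <= k)%N.
    rewrite leqNgt; apply/negP => kj; move: Aj => [_]; apply.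
    by rewrite -bigcup_mkord; exists k => //=; apply: uE Ew.
  apply: le_lt_trans k2; rewrite lerD2r ler_pM2r// ler_nat//.
apply: (@le_trans _ _ (P2 (\bigcup_k B2 k))).
  rewrite !measure_bigcup//; apply: lee_nneseries => // k _.
  exact: H.
apply: le_measure; rewrite ?inE//; first exact: bigcupT_measurable.
move=> w [k _ [[/= Ak _] Zk]]; apply: uE Ak.
by rewrite ltW// -ltrBlDr.
Qed.

(** * Removal of the shift, by absence of atoms *)

(** The events [X = x] and [X <= x - r / 2] are disjoint inside [X <= x], so the atom is at most an
    increment of the distribution function, which continuity makes smaller than any [e]. *)
Lemma continuous_rv_atomless (R : realType) d (O : measurableType d)
    (P : probability O R) (X : {RV P >-> R}) (x : R) :
  continuous_rv X -> P (X @^-1` [set x]) = 0%E.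
Proof.
move=> Xc; apply/eqP; rewrite eq_le measure_ge0 andbT.
apply/lee_addgt0Pr => e e0; rewrite add0e.
have := Xc x; rewrite /continuous_at => /cvgrPdist_lt /(_ e e0).
move=> /nbhs_ballP[r /= r0 /(_ (x - r / 2))].
have r2r : r / 2 < r by rewrite ltr_pdivrMr// ltr_pMr// ltr1n.
have xr : ball x r (x - r / 2).
  by rewrite /ball /= opprB addrC subrK ger0_norm// divr_ge0 ?(ltW r0).
move=> /(_ xr) /(le_lt_trans (ler_norm _)).
rewrite -lte_fin EFinB !fineK ?fin_num_measure// => /ltW h; apply: le_trans h.
rewrite leeBrDr ?fin_num_measure//.
rewrite /cdf /distribution /pushforward /= -measureU//.
- apply: le_measure; rewrite ?inE//.
  + by apply: measurableU; exact: measurable_funPTI.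
  + exact: measurable_funPTI.
  + by move=> w /= [->|]; rewrite !in_itv //= => /le_trans; apply;
    rewrite gerBl ltW// divr_gt0.
- exact: measurable_funPTI.
- rewrite -subset0 => w /= [->];
  rewrite in_itv/= leNgt ltrBlDr ltrDl divr_gt0//.
Qed.

Definition shifted_event (R : realType) (O S : Type) (E : set (S * R))
    (V : O -> S) (Z : O -> R) (a : R) : set O :=
  [set w | E (V w, Z w + a)].

Section shifted_events.
Context (R : realType) d (S : measurableType d) d' (O : measurableType d').
Variables (m : probability O R) (V : O -> S) (Z : O -> R) (E : set (S * R)).
Hypotheses (mV : measurable_fun setT V) (mZ : measurable_fun setT Z).
Hypotheses (mE : measurable E) (uE : up_sections E).

Let D a := shifted_event E V Z a.

Lemma measurable_shifted_event a : measurable (D a).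
Proof.
apply: (@measurable_preimageT _ _ _ _ (fun w => (V w, Z w + a)) E) => //.
by apply: measurable_fun_pair => //; exact: measurable_funD.
Qed.

Lemma le_shifted_event a b : a <= b -> D a `<=` D b.
Proof. by move=> ab w; apply: uE; rewrite lerD2l. Qed.

Hypothesis null : m ((\bigcap_k D k.+1%:R^-1) `\` \bigcup_k D (- k.+1%:R^-1)) =
  0%E.

Let mup : measurable (\bigcap_k D k.+1%:R^-1).
Proof. by apply: bigcapT_measurable => k; exact: measurable_shifted_event. Qed.

Let mlow : measurable (\bigcup_k D (- k.+1%:R^-1)).
Proof. by apply: bigcupT_measurable => k; exact: measurable_shifted_event. Qed.

Let mD := measurable_shifted_event.

Let up_low : (m (\bigcap_k D k.+1%:R^-1) <= m (\bigcup_k D (- k.+1%:R^-1)))%E.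
Proof.
rewrite -[leRHS]adde0 -null -measureU//; last 2 first.
- exact: measurableD.
- by rewrite setDIK.
apply: le_measure; rewrite ?inE//; first exact/measurableU/measurableD.
by move=> w Uw; have [Lw|Lw] := pselect ((\bigcup_k D (- k.+1%:R^-1)) w);
  [left|right].
Qed.

(** Continuity from above makes [c] a lower bound for the intersection of the positive shifts;
    [null] carries it to the union of the negative shifts, which lies in [D 0]. *)
Lemma shifted_event_ge c : (forall e, 0 < e -> (c <= m (D e))%E) -> (c <= m (D
  0))%E.
Proof.
move=> H; apply: (@le_trans _ _ (m (\bigcap_k D k.+1%:R^-1))).
  have cv : m \o (fun k => D k.+1%:R^-1) @ \oo --> m (\bigcap_k D k.+1%:R^-1).
    apply: nonincreasing_cvg_mu => //.
    - by rewrite (le_lt_trans (probability_le1 _ _))// ltry.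
    - by move=> i j ij; apply/subsetPset/le_shifted_event;
      rewrite lef_pV2 ?posrE// ler_nat ltnS.
  rewrite -(cvg_lim _ cv)//; apply: lime_ge; first by apply/cvg_ex; eexists;
    exact: cv.
  by near=> n; apply: H.
apply: (le_trans up_low); apply: le_measure; rewrite ?inE//.
by move=> w [k _]; apply: le_shifted_event; rewrite oppr_le0.
Unshelve. all: by end_near. Qed.

(** Dually, continuity from below bounds the union of the negative shifts, and [null] carries the
    bound to the intersection, which contains [D 0]. *)
Lemma shifted_event_le c : (forall e, 0 < e -> (m (D (- e)) <= c)%E) -> (m (D
  0) <= c)%E.
Proof.
move=> H; apply: (@le_trans _ _ (m (\bigcup_k D (- k.+1%:R^-1)))).
  apply: (le_trans _ up_low); apply: le_measure; rewrite ?inE//.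
  by move=> w Dw k _; apply: le_shifted_event Dw.
have cv : m \o (fun k => D (- k.+1%:R^-1)) @ \oo --> m (\bigcup_k D (-
  k.+1%:R^-1)).
  apply: nondecreasing_cvg_mu => //.
  by move=> i j ij; apply/subsetPset/le_shifted_event;
    rewrite lerN2 lef_pV2 ?posrE// ler_nat ltnS.
rewrite -(cvg_lim _ cv)//; apply: lime_le; first by apply/cvg_ex; eexists;
  exact: cv.
by near=> n; apply: H.
Unshelve. all: by end_near. Qed.

End shifted_events.

(* A section of the boundary event is [X @^-1` J] where [J] has at most one
   point, and [X] has no atom. *)
Lemma boundary_null (R : realType) d (S : measurableType d)
    d1 (O1 : measurableType d1) (Q : probability O1 R)
    d2 (O2 : measurableType d2) (P : probability O2 R) (X : {RV P >-> R})
    (V : O1 -> S) (U : O1 -> R) (E : set (S * R)) :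
  continuous_rv X -> measurable_fun setT V -> measurable_fun setT U ->
  measurable E -> up_sections E ->
  let D := shifted_event E (V \o fst) (fun z => U z.1 + X z.2) in
  (Q \x P)%E ((\bigcap_k D k.+1%:R^-1) `\` \bigcup_k D (- k.+1%:R^-1)) = 0%E.
Proof.
move=> Xc mV mU mE uE D.
set N := (X in _ X = _).
rewrite /product_measure1 /=; apply: integral0_eq => w _ /=.
pose J := [set x | forall k : nat, E (V w, U w + x + k.+1%:R^-1) /\ ~ E (V w, U
  w + x - k.+1%:R^-1)].
have Jle x y : J x -> J y -> y <= x.
  move=> Jx Jy; rewrite leNgt; apply/negP => xy.
  (* Half the gap leaves room for both shifts: [x + k.+1%:R^-1 < y - k.+1%:R^-1], and [E] at the
     left end passes to the right end. *)
  have /ltr_add_invr[k] : 0 < (y - x) / 2 by rewrite divr_gt0// subr_gt0.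
  rewrite add0r => kxy; have [Ex _] := Jx k; have [_] := Jy k; apply.
  apply: uE Ex; move: k.+1%:R^-1 kxy => z; rewrite ltr_pdivlMr// => kxy; lra.
have NJ : xsection N w = X @^-1` J.
  apply/seteqP; split => [w' /xsectionP[h1 h2] k|w' h].
    by split; [exact: h1|move=> h3; apply: h2; exists k].
  apply/xsectionP; split => [k _|[k _]]; first by case: (h k).
  by case: (h k).
have [J0|/set0P[x Jx]] := eqVneq J set0;
  first by rewrite NJ J0 preimage_set0 measure0.
rewrite NJ (_ : J = [set x]) ?continuous_rv_atomless//.
by apply/seteqP; split=> [y Jy|_ ->//]; apply/eqP; rewrite eq_le !Jle.
Qed.

(** * Exchange of a single coordinate, in either direction *)

(* Treats both directions of the theorem at once: [<=] if [b], else [>=]. *)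
Definition le_dir (disp : Order.disp_t) (T : porderType disp) (b : bool) (x y :
  T) :=
  if b then (x <= y)%O else (y <= x)%O.

Lemma le_dir_refl (disp : Order.disp_t) (T : porderType disp) b (x : T) :
  le_dir b x x.
Proof. by case: b => /=. Qed.

Lemma le_dir_trans (disp : Order.disp_t) (T : porderType disp) b (y x z : T) :
  le_dir b x y -> le_dir b y z -> le_dir b x z.
Proof. by case: b => /= xy yz; [exact: le_trans xy yz|exact: le_trans yz xy].
  Qed.

Lemma integrable_unit_valued (R : realType) d (T : measurableType d)
    (P : probability T R) (f : T -> R) :
  measurable_fun setT f -> (forall w, 0 <= f w <= 1) ->
  P.-integrable setT (EFin \o f).
Proof.
move=> mf f01; apply: measurable_bounded_integrable => //.
  by rewrite (le_lt_trans (probability_le1 _ _))// ltry.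
exists 1; split; first exact: num_real.
move=> x x1 w _ /=; have /andP[f0 f1] := f01 w.
by rewrite ger0_norm// (le_trans f1)// ltW.
Qed.

(** The level sets of [g] have up-closed sections. In both directions the shift left by
    [tail_le_shift] must fall on [U z.1 + X z.2]: given the past this sum has no atom, whereas
    nothing of the kind is assumed of [Z]. *)
Lemma one_step_comparison (R : realType) b d (S : measurableType d)
    d1 (O1 : measurableType d1) (Q : probability O1 R)
    d2 (O2 : measurableType d2) (P : probability O2 R) (X : {RV P >-> R})
    (V : O1 -> S) (U Z : O1 -> R) :
  continuous_rv X -> (forall w, 0 <= X w) ->
  measurable_fun setT V -> measurable_fun setT U -> measurable_fun setT Z ->
  (forall w, 0 <= U w) -> (forall w, 0 <= Z w) ->
  (forall A (t : R), measurable A ->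
     le_dir b (Q (V @^-1` A `&` [set w | t < Z w]))
       ((Q \x P)%E ([set z | A (V z.1)] `&` [set z | t < U z.1 + X z.2]))) ->
  forall g : S * R -> R, measurable_fun setT g -> (forall p, 0 <= g p <= 1) ->
    (forall v s t, s <= t -> g (v, s) <= g (v, t)) ->
  le_dir b (\int[Q]_w (g (V w, Z w))%:E)%E
    (\int[Q \x P]_z (g (V z.1, U z.1 + X z.2))%:E)%E.
Proof.
move=> Xc X0 mV mU mZ U0 Z0 H g mg g01 ug.
have mVZ : measurable_fun setT (fun w => (V w, Z w)) by exact:
  measurable_fun_pair.
have mV1 : measurable_fun setT (V \o fst : O1 * O2 -> S) by exact:
  measurableT_comp.
have mUX : measurable_fun setT (fun z : O1 * O2 => U z.1 + X z.2).
  by apply: measurable_funD; exact: measurableT_comp.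
have mVUX : measurable_fun setT (fun z : O1 * O2 => (V z.1, U z.1 + X z.2)).
  exact: measurable_fun_pair.
have i1 : Q.-integrable setT (EFin \o (fun w => g (V w, Z w))).
  by apply: integrable_unit_valued => //; exact: (measurableT_comp mg mVZ).
have i2 : (Q \x P)%E.-integrable setT (EFin \o (fun z : O1 * O2 => g (V z.1, U
  z.1 + X z.2))).
  by apply: integrable_unit_valued => //; exact: (measurableT_comp mg mVUX).
have mE r : measurable [set p | r < g p] by exact: measurable_tail.
have uE r : up_sections [set p | r < g p].
  by move=> v s t st /= /lt_le_trans; apply; exact: ug.
have D0 r : [set z : O1 * O2 | r < g (V z.1, U z.1 + X z.2)] =
    shifted_event [set p | r < g p] (V \o fst) (fun z => U z.1 + X z.2) 0.
  by apply/seteqP; split=> z; rewrite /shifted_event /= addr0.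
have nul r := boundary_null Q Xc mV mU (mE r) (uE r).
case: b H => H; apply: expectation_le_of_tail => // r; rewrite D0.
- apply: (shifted_event_ge mV1 mUX (mE r) (uE r) (nul r)) => e e0.
  exact: (@tail_le_shift _ _ _ _ _ _ _ _ _ _ _ _ _ mV mV1 mZ mUX).
- apply: (shifted_event_le mV1 mUX (mE r) (uE r) (nul r)) => e e0.
  (* With the level set read at [p.2 - e], the shift cancels for [Z] and becomes [- e] for
     [U z.1 + X z.2]. *)
  pose E' := [set p : S * R | r < g (p.1, p.2 - e)].
  have mE' : measurable E'.
    apply: measurable_tail; apply: (measurableT_comp mg).
    by apply: measurable_fun_pair => //; exact: measurable_funB.
  have uE' : up_sections E'.
    by move=> v s t st /= /lt_le_trans; apply; apply: ug; rewrite lerD2r.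
  have UX0 (z : O1 * O2) : 0 <= U z.1 + X z.2 by rewrite addr_ge0.
  have := @tail_le_shift _ _ _ _ _ _ _ _ _ _ _ _ _ mV1 mV mUX mZ UX0 H E' e mE'
    uE' e0.
  congr (_ <= Q _)%E.
  by apply/seteqP; split=> w; rewrite /E' /= addrK.
Qed.

(** * Tuples: prefixes, last entries, measurability and order *)

Lemma val_rvec (O R : Type) n (Z : nat -> O -> R) w :
  tval (rvec n Z w) = [seq Z i w | i <- iota 0 n].
Proof. by rewrite /rvec /= -val_enum_ord -map_comp. Qed.

Lemma rvecS (O R : Type) n (Z : nat -> O -> R) w :
  rvec n.+1 Z w = [tuple of rcons (rvec n Z w) (Z n w)].
Proof. by apply/val_inj; rewrite /= !val_rvec -addn1 iotaD map_cat /= cats1.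
  Qed.

Lemma last_rvecS (O : Type) (R : realType) n (Z : nat -> O -> R) w :
  last 0 (rvec n.+1 Z w) = Z n w.
Proof. by rewrite rvecS /= last_rcons. Qed.

Lemma last_rvec0 (O : Type) (R : realType) (Z : nat -> O -> R) w :
  last 0 (rvec 0 Z w) = 0.
Proof. by rewrite tuple0. Qed.

Lemma measurable_rvec d (O : measurableType d) (R : realType) n (Z : nat -> O
  -> R) :
  (forall k, measurable_fun setT (Z k)) -> measurable_fun setT (rvec n Z).
Proof.
move=> mZ; apply/measurable_fun_tnthP => i.
by rewrite (_ : _ \o _ = Z i)//; apply/funext => w /=; rewrite tnth_mktuple.
Qed.

Lemma measurable_last (R : realType) n :
  measurable_fun setT (fun v : n.-tuple R => last 0 v).
Proof.
case: n => [|n].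
  rewrite (_ : (fun _ => _) = cst 0); first exact: measurable_cst.
  by apply/funext => v; rewrite (tuple0 v).
rewrite (_ : (fun _ => _) = (fun v : n.+1.-tuple R => tnth v ord_max)).
  exact: measurable_tnth.
by apply/funext => v; rewrite (tnth_nth 0) /= -nth_last size_tuple.
Qed.

Lemma le_last (R : realType) n (x y : n.-tuple R) :
  (forall i, tnth x i <= tnth y i) -> last 0 x <= last 0 y.
Proof.
case: n x y => [|n] x y xy; first by rewrite (tuple0 x) (tuple0 y).
by rewrite -!nth_last !size_tuple /= -!(tnth_nth _ _ ord_max).
Qed.

Lemma tnth_rcons_tuple (R : Type) n (v : n.-tuple R) s (i : 'I_n.+1) :
  tnth [tuple of rcons v s] i =
  if insub (val i) is Some j then tnth v j else s.
Proof.
rewrite (tnth_nth s) /= nth_rcons size_tuple; case: insubP => [j jn ji|].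
  by rewrite -ji ltn_ord (tnth_nth s).
by move=> /negbTE ->; case: eqP.
Qed.

Lemma measurable_rcons d (T : measurableType d) n :
  measurable_fun setT (fun p : n.-tuple T * T => [tuple of rcons p.1 p.2]).
Proof.
apply/measurable_fun_tnthP => i.
case Ej : (insub (val i) : option 'I_n) => [j|].
  rewrite (_ : _ \o _ = (fun p : n.-tuple T * T => tnth p.1 j)).
    by apply: (measurableT_comp (measurable_tnth j)).
  by apply/funext => p; rewrite /= tnth_rcons_tuple Ej.
rewrite (_ : _ \o _ = snd)//.
by apply/funext => p; rewrite /= tnth_rcons_tuple Ej.
Qed.

Lemma rcons_le (R : realType) n (x y : n.-tuple R) s t :
  (forall i, tnth x i <= tnth y i) -> s <= t ->
  forall i, tnth [tuple of rcons x s] i <= tnth [tuple of rcons y t] i.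
Proof. by move=> xy st i; rewrite !tnth_rcons_tuple; case: insub. Qed.

(** * Independence of a variable from the preceding ones *)

Definition boxes (R : realType) n : set (set (n.-tuple R)) :=
  [set A | exists2 B : 'I_n -> set R, (forall i, measurable (B i)) &
           A = [set x | forall i, B i (tnth x i)]].

(** A generating preimage under one coordinate is a box whose other sides are full; conversely a box
    is a finite intersection of such preimages. *)
Lemma measurable_tuple_boxes (R : realType) n :
  @measurable _ (n.-tuple R) = <<s @boxes R n >>.
Proof.
apply/seteqP; split.
  apply: smallest_sub; first exact: smallest_sigma_algebra.
  rewrite -bigcup_seq; apply: bigcup_sub => i _ A [B mB <-].
  apply: sub_sigma_algebra; exists (fun j => if j == i then B else setT).
    by move=> j; case: ifP.
  apply/seteqP; split => [x [_ Bx] j|x Bx]; first by case: eqP => [->|].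
  by split=> //; have := Bx i; rewrite eqxx.
apply: smallest_sub; first exact: sigma_algebra_measurable.
move=> A [B mB ->].
rewrite (_ : [set x | _] = \big[setI/setT]_(i < n) ((fun x => tnth x i) @^-1` B
  i)).
  by apply: bigsetI_measurable => i _; apply: measurable_preimageT => //;
    exact: measurable_tnth.
by rewrite -bigcap_seq; apply/seteqP; split => x /= Bx i; [move=> _|];
  apply: Bx; rewrite /= ?mem_index_enum.
Qed.

Lemma setI_closed_boxes (R : realType) n : setI_closed (@boxes R n).
Proof.
move=> A A' [B mB ->] [B' mB' ->]; exists (fun i => B i `&` B' i).
  by move=> i; exact: measurableI.
by apply/seteqP; split=> [x [Bx B'x] i|x Bx]; [split|split=> i;
  have [] := Bx i].
Qed.

(** [C] is indexed by all of [nat] so that one family serves the lengths [n] and [n.+1] in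
    [independent_prefix]. *)
Lemma independent_prefix_box (R : realType) d (O : measurableType d)
    (P : probability O R) (X : nat -> {RV P >-> R}) n (C : nat -> set R) :
  mutually_independent P (fun k => X k) -> (forall k, measurable (C k)) ->
  P (rvec n (fun k => X k) @^-1` [set x | forall i : 'I_n, C i (tnth x i)]) =
  (\prod_(k <- iota 0 n) fine (P (X k @^-1` C k)))%:E.
Proof.
move=> indep mC; rewrite -(indep (iota 0 n) C (iota_uniq _ _) mC) fineK;
  last first.
  apply: fin_num_measure; rewrite bigcap_seq.
  by apply: bigsetI_measurable => i _; exact: measurable_funPTI.
congr (P _); apply/seteqP; split => w /= h.
  move=> k /=; rewrite mem_iota add0n => kn.
  by have := h (Ordinal kn); rewrite tnth_mktuple.
by move=> i; rewrite tnth_mktuple; apply: h; rewrite /= mem_iota add0n /=.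
Qed.

(** Both sides are finite measures in [A] that agree on boxes, a generating class stable under
    intersection. *)
Lemma independent_prefix (R : realType) d (O : measurableType d)
    (P : probability O R) (X : nat -> {RV P >-> R}) n (A : set (n.-tuple R)) (B
      : set R) :
  mutually_independent P (fun k => X k) -> measurable A -> measurable B ->
  P (rvec n (fun k => X k) @^-1` A `&` X n @^-1` B) =
  (P (rvec n (fun k => X k) @^-1` A) * P (X n @^-1` B))%E.
Proof.
move=> indep mA mB; set V := rvec n _.
have mV : measurable_fun setT V by apply: measurable_rvec.
have mD : measurable (X n @^-1` B) by exact: measurable_funPTI.
have fD : P (X n @^-1` B) \is a fin_num by exact: fin_num_measure.
have c0 : 0 <= fine (P (X n @^-1` B)) by rewrite fine_ge0.
have [m1 m1E] : exists m1 : {measure set (n.-tuple R) -> \bar R},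
    forall A, m1 A = P (V @^-1` A `&` X n @^-1` B).
  by unshelve eexists (pushforward (mrestr P mD) V).
have [m2 m2E] : exists m2 : {measure set (n.-tuple R) -> \bar R},
    forall A, m2 A = (P (V @^-1` A) * P (X n @^-1` B))%E.
  unshelve eexists (mscale (NngNum c0) (pushforward P V)) => // A'.
  by rewrite muleC -[in RHS](fineK fD).
rewrite -m1E -m2E.
apply: (measure_unique (@boxes R n) (fun=> setT)) => //.
- exact: measurable_tuple_boxes.
- exact: setI_closed_boxes.
- by move=> _; exists (fun=> setT) => //; apply/seteqP; split.
- by apply/seteqP; split => // x _; exists 0%N.
- move=> _ [C mC ->]; rewrite m1E m2E.
  (* Side [n] is [B], so a box of length [n] together with [B] becomes a box of length [n.+1]. *)
  pose C' k := if k == n then B else if insub k is Some i then C i else setT.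
  have mC' k : measurable (C' k).
    by rewrite /C'; case: ifP => // _; case: insubP.
  have C'E (i : 'I_n) : C' i = C i.
    rewrite /C' ltn_eqF//; case: insubP => [j _ ji|]; last by rewrite ltn_ord.
    by congr C; exact: val_inj.
  have C'n : C' n = B by rewrite /C' eqxx.
  have -> : [set x : n.-tuple R | forall i, C i (tnth x i)] =
      [set x : n.-tuple R | forall i : 'I_n, C' i (tnth x i)].
    by apply/seteqP; split=> x h i; have := h i; rewrite C'E.
  rewrite (independent_prefix_box _ indep mC').
  rewrite -[P (X n @^-1` B)]fineK// -EFinM -C'n.
  have -> : \prod_(k <- iota 0 n) fine (P (X k @^-1` C' k)) * fine (P (X n
    @^-1` C' n)) =
      \prod_(k <- iota 0 n.+1) fine (P (X k @^-1` C' k)).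
    by rewrite -[in RHS]addn1 iotaD big_cat big_seq1.
  rewrite -(independent_prefix_box n.+1 indep mC'); congr (P _).
  apply/seteqP; split => w /=.
    move=> [h1 h2] i; rewrite tnth_mktuple.
    have := ltn_ord i; rewrite ltnS leq_eqVlt => /orP[/eqP ->//|iN].
    by have := h1 (Ordinal iN); rewrite /V tnth_mktuple.
  move=> h; split; last by have := h ord_max; rewrite tnth_mktuple.
  by move=> i; have := h (widen_ord (leqnSn n) i); rewrite /V !tnth_mktuple.
- by move=> _; rewrite m1E (le_lt_trans (probability_le1 _ _)) ?ltry//;
  apply: measurableI => //; exact: measurable_preimageT.
Qed.

(** Rectangles determine the joint law, which is therefore the product of the two laws; Tonelli then
    splits off an independent copy of [X]. *)
Lemma integral_independent (R : realType) d (O : measurableType d)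
    (P : probability O R) dS (S : measurableType dS) (V : O -> S) (X : O -> R)
    (h : S * R -> \bar R) :
  measurable_fun setT V -> measurable_fun setT X ->
  (forall A B, measurable A -> measurable B ->
     P (V @^-1` A `&` X @^-1` B) = (P (V @^-1` A) * P (X @^-1` B))%E) ->
  measurable_fun setT h -> (forall p, 0 <= h p)%E ->
  (\int[P]_w h (V w, X w) = \int[P]_w \int[P]_w' h (V w, X w'))%E.
Proof.
move=> mV mX indep mh h0.
pose V' : {RV P >-> S} := HB.pack V (isMeasurableFun.Build _ _ _ _ V mV).
pose X' : {RV P >-> R} := HB.pack X (isMeasurableFun.Build _ _ _ _ X mX).
have mVX : measurable_fun setT (fun w => (V w, X w)) by exact:
  measurable_fun_pair.
pose VX' : {RV P >-> (S * R)%type} := HB.pack (fun w => (V w, X w))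
  (isMeasurableFun.Build _ _ _ _ (fun w => (V w, X w)) mVX).
have E A : measurable A -> (distribution P V' \x distribution P X')%E A =
  distribution P VX' A.
  by apply: product_measure_unique => A' B' mA' mB';
    rewrite /distribution /pushforward /= -indep.
rewrite -(ge0_integral_distribution VX' mh h0).
rewrite (eq_measure_integral (distribution P V' \x distribution P X')%E);
  last first.
  by move=> A0 mA _; exact/esym/E.
rewrite fubini_tonelli1//.
have mF := @measurable_fun_fubini_tonelli_F _ _ _ _ _ (distribution P X') h mh
  h0.
rewrite (ge0_integral_distribution V' mF); last first.
  by move=> v; apply: integral_ge0.
apply: eq_integral => w _ /=; rewrite /fubini_F.
rewrite (ge0_integral_distribution X')//.
by apply: (measurableT_comp mh); exact: measurable_fun_pair.
Qed.

(** The section at [w] is a tail event of [X] if [V w] lies in [A], and empty otherwise. This gives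
    the shape of the conditional law in [relevation_process], ready for a pointwise comparison. *)
Lemma product_rect_tail (R : realType) dS (S : measurableType dS)
    d1 (O1 : measurableType d1) (Q : probability O1 R)
    d2 (O2 : measurableType d2) (P : probability O2 R) (X : {RV P >-> R})
    (V : O1 -> S) (U : O1 -> R) (A : set S) (t : R) :
  (Q \x P)%E ([set z | A (V z.1)] `&` [set z | t < U z.1 + X z.2]) =
  (\int[Q]_(w in V @^-1` A) ccdf X (t - U w))%E.
Proof.
rewrite /product_measure1 /= [RHS]integral_mkcond; apply: eq_integral => w _ /=.
rewrite patchE; case: ifPn => wA.
  congr (P _); apply/seteqP; split => [w' /xsectionP[_ /=]|w' /= h].
    by rewrite in_itv/= andbT ltrBlDl.
  by apply/xsectionP; split; [exact: set_mem wA|move: h;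
    rewrite in_itv/= andbT ltrBlDl].
rewrite (_ : xsection _ _ = set0) ?measure0//.
by rewrite -subset0 => w' /xsectionP[/= Aw _]; move/negP: wA; apply;
  exact: mem_set.
Qed.

Lemma ccdfE (R : realType) d (O : measurableType d) (P : probability O R)
  (X : {RV P >-> R}) t : ccdf X t = P [set w | t < X w].
Proof. by rewrite /ccdf /distribution /pushforward set_itvoy. Qed.

(** * Exchange of relevation times for renewal times *)

Section relevation_renewal.
Context (R : realType) d (Omega : measurableType d) (P : probability Omega R)
  d' (Omega' : measurableType d') (Q : probability Omega' R).
Variables (X Y : nat -> {RV P >-> R}) (T : nat -> {RV Q >-> R}) (b : bool).
Hypothesis indepX : mutually_independent P (fun n => X n).
Hypothesis X0 : forall n w, 0 <= X n w.
Hypothesis Xc : forall n, continuous_rv (X n).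
Hypothesis relT : relevation_process T Y.
Hypothesis cmp0 : forall s : R, le_dir b (ccdf (Y 0%N) s) (ccdf (X 0%N) s).
Hypothesis cmpS : forall n (t : R), (1 <= n)%N -> 0 < t -> forall s : R,
  le_dir b (condprob P [set w | s < Y n w - t] [set w | t < Y n w])
    (fine (ccdf (X n) s)).

Let VT n : Omega' -> n.-tuple R := rvec n (fun k => T k).

Let mVT n : measurable_fun setT (VT n).
Proof. exact: measurable_rvec. Qed.

Let T_gt0 n w : 0 < T n w.
Proof.
case: relT => h0 hS _ _; elim: n => [|n IH]; first exact: h0.
exact: lt_trans IH (hS n w).
Qed.

Let last_VT_ge0 n w : 0 <= last 0 (VT n w).
Proof. by case: n => [|n]; rewrite ?last_rvec0// last_rvecS ltW. Qed.

(** For [u <= t] this is [cmpS] at age [u] with excess [t - u], the joint event being survival past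
    [t]. For [t < u] both sides are 1, since lifetimes are nonnegative. *)
Lemma relevation_survival_cmp n (t u : R) : 0 < u ->
  le_dir b (if t < u then 1 else fine (ccdf (Y n.+1) t) / fine (ccdf (Y n.+1)
    u))%:E
    (ccdf (X n.+1) (t - u)).
Proof.
move=> u0; case: ltP => tu.
  rewrite ccdfE (_ : [set w | _] = setT) ?probability_setT;
    first exact: le_dir_refl.
  by apply/seteqP; split => // w _ /=;
    rewrite (lt_le_trans _ (X0 _ _))// subr_lt0.
have := cmpS (ltn0Sn n) u0 (t - u); rewrite /condprob.
have -> : [set w | t - u < Y n.+1 w - u] `&` [set w | u < Y n.+1 w] = [set w |
  t < Y n.+1 w].
  apply/seteqP; split => w /=; rewrite ltrBlDr subrK; first by case.
  by move=> h; split => //; exact: le_lt_trans h.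
rewrite -!ccdfE => h.
have cf : ccdf (X n.+1) (t - u) = (fine (ccdf (X n.+1) (t - u)))%:E.
  by rewrite fineK// fin_num_measure.
by rewrite cf; case: b h => /=; rewrite lee_fin.
Qed.

Lemma measurable_survival_ratio n (t : R) :
  measurable_fun setT (fun w => (if t < T n w then 1
     else fine (ccdf (Y n.+1) t) / fine (ccdf (Y n.+1) (T n w)))%:E).
Proof.
apply/measurable_EFinP; apply: measurable_fun_ifT => //.
  exact: measurable_fun_ltr.
apply: measurable_funM => //.
(* The reciprocal is taken as a power, and the survival function is Borel because it is monotone. *)
rewrite (_ : (fun _ => _) = (@powR R ^~ (-1)) \o (fun u => fine (ccdf (Y n.+1)
  u)) \o T n).
  apply: measurableT_comp => //; apply: measurableT_comp;
    first exact: measurable_powR.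
  apply: nonincreasing_measurable => // u v uv.
  by apply: fine_le; rewrite ?fin_num_measure//; exact: ccdf_nonincreasing.
by apply/funext => w /=; rewrite powR_inv1// fine_ge0.
Qed.

(* [last 0] of the empty past is [0], so that [n = 0] is the comparison of the
   first failure times. *)
Lemma rectangle_cmp n (A : set (n.-tuple R)) (t : R) : measurable A ->
  le_dir b (Q (VT n @^-1` A `&` [set w | t < T n w]))
   ((Q \x P)%E ([set z | A (VT n z.1)] `&` [set z | t < last 0 (VT n z.1) + X n
     z.2])).
Proof.
move=> mA; rewrite (product_rect_tail _ _ _ (fun w => last 0 (VT n w))).
have mVA : measurable (VT n @^-1` A) := measurable_preimageT (@mVT n) mA.
case: n A mA mVA => [|n] A mA mVA.
  have [A0|A0] := pselect (A [tuple]).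
    have -> : VT 0 @^-1` A = setT.
      by apply/seteqP; split => // w _ /=; rewrite (tuple0 (VT 0 w)).
    rewrite setTI (_ : [set w | _] = T 0%N @^-1` `]t, +oo[);
      last by rewrite set_itvoy.
    case: relT => _ _ /(_ t); rewrite {1}/ccdf => + _.
    rewrite /distribution /pushforward => ->.
    under eq_integral do rewrite last_rvec0 subr0.
    rewrite integral_cst//; have := cmp0 t.
    by rewrite -[ccdf (X _) t]mule1 -(probability_setT Q).
  have -> : VT 0 @^-1` A = set0.
    by rewrite -subset0 => w /=; rewrite (tuple0 (VT 0 w)).
  by rewrite set0I measure0 integral_set0; exact: le_dir_refl.
(* Both sides become integrals over the same event of the past; the integrands are compared at each
   [T n w], which is positive as [cmpS] requires. *)
case: relT => _ _ _ ->//.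
under [X in le_dir b _ X]eq_integral do rewrite last_rvecS.
have mk := measurable_survival_ratio n t.
have mc : measurable_fun setT (fun w => ccdf (X n.+1) (t - T n w)).
  by apply: (measurableT_comp (ccdf_measurable (X n.+1)));
    exact: measurable_funB.
have k0 w : (0 <= (if t < T n w then 1
     else fine (ccdf (Y n.+1) t) / fine (ccdf (Y n.+1) (T n w)))%:E)%E.
  by rewrite lee_fin; case: ifP => // _; rewrite divr_ge0// fine_ge0.
have := fun w => relevation_survival_cmp n t (T_gt0 n w).
by case: b => /= h; apply: ge0_le_integral => //; exact: measurable_funTS.
Qed.

Let VX n : Omega -> n.-tuple R := rvec n (renewal_times (fun k => X k)).

Lemma measurable_renewal_times n : measurable_fun setT (renewal_times (fun k =>
  X k) n).
Proof. exact: measurable_sum. Qed.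

Let mVX n : measurable_fun setT (VX n).
Proof. by apply: measurable_rvec; exact: measurable_renewal_times. Qed.

Lemma renewal_timesE n w :
  last 0 (VX n w) + X n w = renewal_times (fun k => X k) n w.
Proof.
case: n => [|n]; rewrite /renewal_times big_ord_recr /=.
  by rewrite big_ord0 last_rvec0.
by rewrite last_rvecS.
Qed.

(** Writes the past failure times as a measurable function of the past lifetimes, so that they
    inherit independence from [X n]. *)
Let partial_sums n (v : n.-tuple R) : n.-tuple R :=
  [tuple \sum_(j < (nat_of_ord i).+1) nth 0 v j | i < n].

Let measurable_partial_sums n : measurable_fun setT (@partial_sums n).
Proof.
apply/measurable_fun_tnthP => i.
rewrite (_ : _ \o _ = fun v : n.-tuple R => \sum_(j < i.+1) nth 0 v j);
  last first.
  by apply/funext => v /=; rewrite tnth_mktuple.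
apply: measurable_sum => j; have [jn|nj] := ltnP j n.
  rewrite (_ : (fun _ => _) = (fun v : n.-tuple R => tnth v (Ordinal jn))).
    exact: measurable_tnth.
  by apply/funext => v; rewrite (tnth_nth 0).
rewrite (_ : (fun _ => _) = cst 0)//.
by apply/funext => v; rewrite nth_default// size_tuple.
Qed.

Let VXE n : VX n = @partial_sums n \o rvec n (fun k => X k).
Proof.
apply/funext => w; apply: eq_from_tnth => i; rewrite !tnth_mktuple.
apply: eq_bigr => j _; have jn : (j < n)%N by rewrite (leq_trans (ltn_ord j)).
by rewrite -[nat_of_ord j]/(nat_of_ord (Ordinal jn)) -(tnth_nth _ (rvec n _ w))
  tnth_mktuple.
Qed.

(** Values in [[0, 1]] are preserved by averaging over [X n] and keep every integral finite, so the
    induction carries no integrability condition. *)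
Lemma expectation_cmp n (f : n.-tuple R -> R) :
  measurable_fun setT f -> coord_increasing f -> (forall v, 0 <= f v <= 1) ->
  le_dir b (\int[Q]_w (f (VT n w))%:E)%E (\int[P]_w (f (VX n w))%:E)%E.
Proof.
elim: n f => [|n IH] f mf uf f01.
  under eq_integral do rewrite (tuple0 (VT 0 _)).
  under [X in le_dir b _ X]eq_integral do rewrite (tuple0 (VX 0 _)).
  rewrite !integral_cst//.
  have := le_dir_refl b ((f [tuple])%:E * 1)%E.
  by rewrite -{1}(probability_setT Q) -(probability_setT P).
pose g (p : n.-tuple R * R) := f [tuple of rcons p.1 p.2].
have mg : measurable_fun setT g by apply: (measurableT_comp mf);
  exact: measurable_rcons.
pose h (p : n.-tuple R * R) := (g (p.1, last 0 p.1 + p.2))%:E.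
have mh : measurable_fun setT h.
  apply/measurable_EFinP; apply: (measurableT_comp mg).
  apply: measurable_fun_pair => //; apply: measurable_funD => //.
  by apply: (measurableT_comp (@measurable_last R n)).
have h01 p : (0 <= h p <= 1)%E by rewrite !lee_fin; exact: f01.
have h0 p : (0 <= h p)%E by case/andP: (h01 p).
pose Mf v := (\int[P]_w h (v, X n w))%E.
have mhX v : measurable_fun setT (fun w => h (v, X n w)).
  by apply: (measurableT_comp mh); exact: measurable_fun_pair.
have Mf01 v : (0 <= Mf v <= 1)%E.
  rewrite integral_ge0//=.
  apply: (@le_trans _ _ (\int[P]_w cst 1 w)%E).
    by apply: ge0_le_integral => // w _; case/andP: (h01 (v, X n w)).
  by rewrite integral_cst// mul1e; exact: probability_le1.
have MfE v : (fine (Mf v))%:E = Mf v.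
  rewrite fineK// ge0_fin_numE; last by case/andP: (Mf01 v).
  by rewrite (@le_lt_trans _ _ 1%E) ?ltry//; case/andP: (Mf01 v).
have mMf : measurable_fun setT (fine \o Mf).
  apply: measurableT_comp => //.
  have mhX2 : measurable_fun setT (fun p : n.-tuple R * Omega => h (p.1, X n
    p.2)).
    by apply: (measurableT_comp mh); apply: measurable_fun_pair => //;
      exact: measurableT_comp.
  exact: (@measurable_fun_fubini_tonelli_F _ _ _ _ _ P _ mhX2).
(* A larger past raises both the prefix and the time to which [X n] is added. *)
have uMf : coord_increasing (fine \o Mf).
  move=> x y xy; rewrite -lee_fin /= !MfE; apply: ge0_le_integral => // w _.
  by rewrite lee_fin; apply: uf; apply: rcons_le => //; rewrite lerD2r;
    exact: le_last.
have Mf01' v : 0 <= (fine \o Mf) v <= 1 by rewrite -!lee_fin /= MfE;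
  exact: Mf01.
have ug v s t : s <= t -> g (v, s) <= g (v, t).
  by move=> st; apply: uf; exact: rcons_le.
have mU : measurable_fun setT (fun w => last 0 (VT n w)).
  by apply: (measurableT_comp (@measurable_last R n)); exact: mVT.
(* Here [T n] gives way to [last 0 (VT n w)] plus a copy of [X n] living on the second factor of the
   product space. *)
have st := one_step_comparison (@Xc n) (@X0 n) (@mVT n) mU (measurable_funP (T
  n))
  (last_VT_ge0 n)  (fun w => ltW (T_gt0 n w)) (@rectangle_cmp n) mg (fun p =>
    f01 _) ug.
under eq_integral do rewrite /VT rvecS.
apply: (le_dir_trans st).
have mz : measurable_fun setT (fun z : Omega' * Omega => (VT n z.1, X n z.2)).
  apply: measurable_fun_pair; last exact: measurableT_comp.
  by apply: (measurableT_comp (@mVT n)).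
(* Integrating that copy out leaves [Mf] of the past, to which the induction hypothesis applies. *)
rewrite (fubini_tonelli1 _ (measurableT_comp mh mz) (fun z => h0 (VT n z.1, X n
  z.2))).
have := IH _ mMf uMf Mf01'; congr le_dir.
  by apply: eq_integral => w _; rewrite /= MfE.
under eq_integral do rewrite /= MfE.
(* On the renewal side [X n] is independent of [VX n], so averaging [Mf] over the past restores the
   actual next failure time. *)
rewrite -(@integral_independent _ _ _ P _ _ (VX n) (X n) h)//; last 2 first.
- exact: mVX.
- move=> A B mA mB; rewrite VXE comp_preimage.
  by apply: independent_prefix => //;
    apply: (measurable_preimageT (@measurable_partial_sums n)).
by apply: eq_integral => w _; rewrite /h /g /= renewal_timesE -rvecS.
Qed.

Lemma upper_set_cmp n (U : set (n.-tuple R)) : measurable U ->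
  (forall x y : n.-tuple R, (forall i, tnth x i <= tnth y i) -> U x -> U y) ->
  le_dir b (Q (VT n @^-1` U)) (P (VX n @^-1` U)).
Proof.
move=> mU uU.
have mI : measurable_fun setT (\1_U : n.-tuple R -> R) by exact:
  measurable_indic.
have := @expectation_cmp n _ mI.
have iE d0 (O : measurableType d0) (m : probability O R) (V : O -> n.-tuple R) :
    measurable_fun setT V -> (\int[m]_w (\1_U (V w))%:E = m (V @^-1` U))%E.
  move=> mV; rewrite -[in RHS](setIT (V @^-1` U)) -integral_indic//.
  exact: measurable_preimageT.
rewrite (iE _ _ _ _ (@mVT n)) (iE _ _ _ _ (@mVX n)); apply.
- move=> x y xy; rewrite !indicE; case: (boolP (x \in U)) => // xU.
  by rewrite (mem_set (uU _ _ xy (set_mem xU))).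
- by move=> v; rewrite indicE; case: (v \in U); rewrite lexx ler01.
Qed.

(** * Vector order and counting processes *)

(** [expectation_cmp] does not cover an unbounded or signed [phi], but the level sets of [phi] are
    upper sets, and comparing their probabilities is enough. *)
Lemma vector_order n : if b then st_le_vec Q (VT n) P (VX n) else st_le_vec P
  (VX n) Q (VT n).
Proof.
have H (phi : n.-tuple R -> R) (r : R) : measurable_fun setT phi ->
  coord_increasing phi ->
    le_dir b (Q [set w | r < phi (VT n w)]) (P [set w | r < phi (VX n w)]).
  move=> mphi uphi; apply: (@upper_set_cmp n [set v | r < phi v]).
    exact: measurable_tail.
  by move=> x y xy /= /lt_le_trans; apply; exact: uphi.
case: b H => /= H phi mphi uphi i1 i2; apply: expectation_le_of_tail => // r;
  exact: H.
Qed.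

(** More than [r] failures means at least [(Num.truncn r).+1] of them, and with indices from 0 that
    failure has index [Num.truncn r]. The condition [0 <= r] rules out the value 0 adjoined to the
    supremum. *)
Lemma lt_count_proc (O : Type) (Z : nat -> O -> R) (t r : R) w :
  (forall k, Z k w <= Z k.+1 w) -> 0 <= r ->
  (r%:E < count_proc Z t w)%E = (Z (Num.truncn r) w <= t).
Proof.
move=> Zle r0; have Zmono : {homo (Z ^~ w) : m n / (m <= n)%N >-> m <= n}.
  by apply: homo_leq => //; exact: le_trans.
apply/idP/idP => [/ereal_sup_gt[x]|Zt].
  case=> [-> |[k /= Zk <-]]; first by rewrite lte_fin ltNge r0.
  rewrite lte_fin => rk; apply: le_trans Zk; apply: Zmono.
  by rewrite -ltnS -(ltr_nat R); apply: le_lt_trans rk; rewrite truncn_le.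
apply: (@lt_le_trans _ _ (Num.truncn r).+1%:R%:E).
  by rewrite lte_fin; have /andP[] := truncn_itv r0.
by apply: ereal_sup_ubound; right; exists (Num.truncn r).
Qed.

(** A count exceeding [r >= 0] is the complement of a tail event of one failure time, which reverses
    the order; for [r < 0] both events are certain. *)
Lemma counting_order (t : R) :
  if b then st_le_ext P (count_proc (renewal_times (fun k => X k)) t) Q
    (count_proc (fun k => T k) t)
  else st_le_ext Q (count_proc (fun k => T k) t) P (count_proc (renewal_times
    (fun k => X k)) t).
Proof.
have neg (O : Type) (Z : nat -> O -> R) r : r < 0 -> [set w | (r%:E <
  count_proc Z t w)%E] = setT.
  move=> r0; apply/seteqP; split => // w _ /=;
    apply: (@lt_le_trans _ _ 0%E) => //.
  by apply: ereal_sup_ubound; left.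
have pos (O : Type) (Z : nat -> O -> R) r : (forall k w, Z k w <= Z k.+1 w) ->
  0 <= r ->
    [set w | (r%:E < count_proc Z t w)%E] = ~` [set w | t < Z (Num.truncn r) w].
  move=> Zle r0; apply/seteqP; split => w /=; rewrite lt_count_proc// leNgt;
    first exact/negP.
  by move/negP.
have HT k w : T k w <= T k.+1 w by case: relT => _ hS _ _; exact/ltW/hS.
have HX k w : renewal_times (fun k => X k) k w <= renewal_times (fun k => X k)
  k.+1 w.
  by rewrite [leRHS]/renewal_times big_ord_recr lerDl; exact: X0.
have tail k : le_dir b (Q [set w | t < T k w]) (P [set w | t < renewal_times
  (fun k => X k) k w]).
  (* Seen as the last coordinate of a prefix, a failure time has upper sets as tail events. *)
  have -> : [set w | t < T k w] = VT k.+1 @^-1` [set v | t < last 0 v].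
    by apply/funext => w; rewrite /preimage /mkset last_rvecS.
  have -> : [set w | t < renewal_times (fun k => X k) k w] = VX k.+1 @^-1` [set
    v | t < last 0 v].
    by apply/funext => w; rewrite /preimage /mkset last_rvecS.
  apply: upper_set_cmp; first by apply: measurable_tail; exact: measurable_last.
  by move=> x y xy /= /lt_le_trans; apply; exact: le_last.
have mX k : measurable [set w | t < renewal_times (fun k => X k) k w].
  by apply: measurable_tail; exact: measurable_renewal_times.
have mT k : measurable [set w | t < T k w] by exact: measurable_tail.
case: b tail => /= tail r; have [r0|r0] := ltP r 0.
- by rewrite !neg// !probability_setT.
- by rewrite !pos// !probability_setC//; apply: leeB.
- by rewrite !neg// !probability_setT.
- by rewrite !pos// !probability_setC//; apply: leeB.
Qed.

End relevation_renewal.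

(* 0-based indexing: X 0 = X_1, Y 0 = Y_1, T 0 = T_1; condition (b) "n >= 2"
   becomes "1 <= n". *)
Theorem theorem3p4 (R : realType)
    (d : measure_display) (Omega : measurableType d) (P : probability Omega R)
    (d' : measure_display) (Omega' : measurableType d') (Q : probability Omega' R)
    (X Y : nat -> {RV P >-> R}) (T : nat -> {RV Q >-> R}) :
  mutually_independent P (fun n => X n) ->
  mutually_independent P (fun n => Y n) ->
  (forall n w, 0 <= X n w) -> (forall n w, 0 <= Y n w) ->
  (forall n, continuous_rv (X n)) -> (forall n, continuous_rv (Y n)) ->
  (forall n (t : R), 0 <= t -> (0 < ccdf (Y n) t)%E) ->
  relevation_process T Y ->
  (* increasing direction *)
  ( ((forall s : R, (ccdf (Y 0%N) s <= ccdf (X 0%N) s)%E) /\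
     (forall n (t : R), (1 <= n)%N -> 0 < t -> forall s : R,
        condprob P [set w | s < Y n w - t] [set w | t < Y n w]
          <= fine (ccdf (X n) s))) ->
    (forall n, (1 <= n)%N ->
       st_le_vec Q (rvec n (fun k => T k)) P (rvec n (renewal_times (fun k => X k)))) /\
    (forall t : R, 0 <= t ->
       st_le_ext P (count_proc (renewal_times (fun k => X k)) t)
                 Q (count_proc (fun k => T k) t)) ) /\
  (* decreasing direction *)
  ( ((forall s : R, (ccdf (X 0%N) s <= ccdf (Y 0%N) s)%E) /\
     (forall n (t : R), (1 <= n)%N -> 0 < t -> forall s : R,
        fine (ccdf (X n) s)
          <= condprob P [set w | s < Y n w - t] [set w | t < Y n w])) ->
    (forall n, (1 <= n)%N ->
       st_le_vec P (rvec n (renewal_times (fun k => X k))) Q (rvec n (fun k => T k))) /\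
    (forall t : R, 0 <= t ->
       st_le_ext Q (count_proc (fun k => T k) t)
                 P (count_proc (renewal_times (fun k => X k)) t)) ).

Proof.
move=> indepX _ X0 _ Xc _ _ relT; split=> [[cmp0 cmpS]|[cmp0 cmpS]].
- split=> [n _|t _].
    exact: (vector_order (b := true) indepX X0 Xc relT cmp0 cmpS n).
  exact: (counting_order (b := true) indepX X0 Xc relT cmp0 cmpS t).
- split=> [n _|t _].
    exact: (vector_order (b := false) indepX X0 Xc relT cmp0 cmpS n).
  exact: (counting_order (b := false) indepX X0 Xc relT cmp0 cmpS t).
Qed.
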